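(* In the configuration of circles described in the context, the tangency of the two pairs of circles meeting at the point $S_i$ (the circle through $S_{i-1},S_i^-,S_i$ with the circle through $S_i,S_{i+1},S_i^+$, and the circle through $S_{i+1},S_i^-,S_i$ with the circle through $S_i,S_{i-1},S_i^+$) is equivalent to the following equations, which are equivalent to each other: $$\frac1{S_i^+-S_i}+\frac1{S_i^--S_i}=\frac1{S_{i+1}-S_i}+\frac1{S_{i-1}-S_i},$$ $$\frac{(S_i^+-S_{i+1})(S_i-S_i^-)(S_i-S_{i-1})}{(S_i^+-S_i)(S_{i+1}-S_i)(S_i^--S_{i-1})}=-1,$$ $$\frac{(S_i^+-S_{i-1})(S_i-S_i^-)(S_{i+1}-S_i)}{(S_i^+-S_i)(S_i-S_{i-1})(S_i^--S_{i+1})}=-1.$$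
   Context: The ground field is $\mathbf C$. The configuration is given by the following local rule for constructing a point $S_i^+$ from points $S_{i-1},S_i,S_{i+1}$ and $S_i^-$. Draw the circle through the points $S_{i-1},S_i^-,S_i$, and then draw the circle through the points $S_i,S_{i+1}$ tangent (at $S_i$) to the previous circle. Repeat the construction: draw the circle through the points $S_{i+1},S_i^-,S_i$, and then draw the circle through the points $S_i,S_{i-1}$ tangent (at $S_i$) to the previous circle. Finally, $S_i^+$ is the intersection point of the two ''new'' circles (the second one drawn in each step). The displayed equations are those describing the leapfrog map, in which $S_i^+$ is the result of applying to $S_i^-$ the unique projective involution that fixes $S_i$ and interchanges $S_{i-1}$ and $S_{i+1}$. *)

(* Defs.v *)
From Stdlib Require Import Reals Lra.
From Coquelicot Require Import Coquelicot.

Open Scope C_scope.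

Definition line (p d z : C) : Prop := exists t : R, z = p + t * d.

(* Circles in the sense of Moebius geometry, i.e. of CP^1: the finite part of
   a circle is a Euclidean circle or a straight line. *)
Inductive gcircle : Type :=
  | Circle (c : C) (r : R) (r_pos : (0 < r)%R)
  | Line (p d : C) (d_neq0 : d <> 0).

Definition on (G : gcircle) (z : C) : Prop :=
  match G with
  | Circle c r _ => Cmod (z - c) = r
  | Line p d _ => line p d z
  end.

Definition through (G : gcircle) (x y z : C) : Prop :=
  on G x /\ on G y /\ on G z.

(* Meaningful only when p lies on G. *)
Definition tangent_line (G : gcircle) (p : C) : C -> Prop :=
  match G with
  | Circle c _ _ => line p (Ci * (p - c))
  | Line q d _ => line q d
  end.

Definition tangent_at (p : C) (G H : gcircle) : Prop :=
  on G p /\ on H p /\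
  forall z : C, tangent_line G p z <-> tangent_line H p z.

Definition concyclic (x y z w : C) : Prop :=
  exists G : gcircle, on G x /\ on G y /\ on G z /\ on G w.

Lemma through_exists (x y z : C) :
  x <> y -> y <> z -> x <> z -> exists G : gcircle, through G x y z.
Proof.
intros xy yz xz.
assert (hd : y - x <> 0).
{ intro h; apply xy; replace y with (y - x + x) by ring; rewrite h; ring. }
destruct x as [a b], y as [a1 b1], z as [a2 b2].
set (u1 := (a1 - a)%R); set (v1 := (b1 - b)%R).
set (u2 := (a2 - a)%R); set (v2 := (b2 - b)%R).
assert (n1 : (u1 * u1 + v1 * v1 <> 0)%R).
{ intro h; apply xy; unfold u1, v1 in h.
  apply Rplus_sqr_eq_0 in h; f_equal; lra. }
destruct (Req_dec (u1 * v2 - u2 * v1) 0) as [col | ncol].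
- exists (Line (a, b) ((a1, b1) - (a, b)) hd); repeat split; simpl.
  + exists 0%R; apply injective_projections; simpl; ring.
  + exists 1%R; apply injective_projections; simpl; ring.
  + exists ((u1 * u2 + v1 * v2) / (u1 * u1 + v1 * v1))%R.
    assert (k1 : (u2 = (u1 * u2 + v1 * v2) / (u1 * u1 + v1 * v1) * u1)%R).
    { apply Rmult_eq_reg_r with (u1 * u1 + v1 * v1)%R; trivial.
      transitivity ((u1 * u2 + v1 * v2) * u1)%R; [| field; trivial].
      transitivity ((u1 * u2 + v1 * v2) * u1 - v1 * (u1 * v2 - u2 * v1))%R;
        [ring | rewrite col; ring]. }
    assert (k2 : (v2 = (u1 * u2 + v1 * v2) / (u1 * u1 + v1 * v1) * v1)%R).
    { apply Rmult_eq_reg_r with (u1 * u1 + v1 * v1)%R; trivial.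
      transitivity ((u1 * u2 + v1 * v2) * v1)%R; [| field; trivial].
      transitivity ((u1 * u2 + v1 * v2) * v1 + u1 * (u1 * v2 - u2 * v1))%R;
        [ring | rewrite col; ring]. }
    apply injective_projections; simpl; unfold u1, v1, u2, v2 in *; lra.
- set (D := (2 * (u1 * v2 - u2 * v1))%R).
  set (m := ((v2 * (u1*u1 + v1*v1) - v1 * (u2*u2 + v2*v2)) / D)%R).
  set (n := ((u1 * (u2*u2 + v2*v2) - u2 * (u1*u1 + v1*v1)) / D)%R).
  assert (hD : D <> 0%R) by (unfold D; lra).
  assert (e1 : (2 * (u1 * m + v1 * n) = u1*u1 + v1*v1)%R).
  { unfold m, n, D; field; trivial. }
  assert (e2 : (2 * (u2 * m + v2 * n) = u2*u2 + v2*v2)%R).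
  { unfold m, n, D; field; trivial. }
  assert (hr : (0 < sqrt (m * m + n * n))%R).
  { apply sqrt_lt_R0.
    destruct (Req_dec m 0) as [hm|]; [|nra].
    destruct (Req_dec n 0) as [hn|]; [|nra].
    exfalso; apply n1; rewrite <- e1, hm, hn; ring. }
  exists (Circle (a + m, b + n)%R _ hr).
  unfold through, on, Cmod; simpl.
  repeat split; f_equal; [ring | |].
  + replace a1 with (a + u1)%R by (unfold u1; ring).
    replace b1 with (b + v1)%R by (unfold v1; ring). nra.
  + replace a2 with (a + u2)%R by (unfold u2; ring).
    replace b2 with (b + v2)%R by (unfold v2; ring). nra.
Qed.

(* Main.v *)
(** The inversion [w = 1 / (z - S)] sends a circle through [S] to the line
    [Re (n * w) = k], whose normal [n] also spans (after a quarter turn) the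
    tangent direction of the circle at [S]; hence tangency at [S] is parallelism
    of the image lines. With [l, r, m, p] the images of [Sl, Sr, Sm, Sp], the two
    tangencies say that [l - m] is parallel to [r - p] and [r - m] to [l - p].
    As [l, r, m] are not collinear, this means that [m, l, p, r] is a
    parallelogram, i.e. [p + m = r + l], which is the first equation. *)

Require Import Defs.
From Stdlib Require Import Reals Lra.
From Coquelicot Require Import Coquelicot.

Open Scope C_scope.

(** * Parallelism in the complex plane over the reals *)

(** The imaginary part of the conjugate of [u] times [v]; it vanishes exactly when the two vectors
    are parallel over the reals. *)
Definition cross (u v : C) : R := (fst u * snd v - snd u * fst v)%R.

Lemma C_norm2_neq0 (u : C) :
  u <> 0 -> (fst u * fst u + snd u * snd u <> 0)%R.
Proof.
intros hu h; apply hu; apply Rplus_sqr_eq_0 in h.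
now apply injective_projections.
Qed.

Lemma Csub_neq0 (x y : C) : x <> y -> x - y <> 0.
Proof. intros h e; apply h; replace x with (x - y + y) by ring; rewrite e; ring. Qed.

Lemma fst_Cminus (x y : C) : fst (x - y) = (fst x - fst y)%R.
Proof. reflexivity. Qed.

Lemma fst_Cplus (x y : C) : fst (x + y) = (fst x + fst y)%R.
Proof. reflexivity. Qed.

Lemma fst_scal (t : R) (x : C) : fst (t * x) = (t * fst x)%R.
Proof. destruct x; simpl; ring. Qed.

Lemma Cinv_sub_inj (x y s : C) :
  x <> s -> y <> s -> / (x - s) = / (y - s) -> x = y.
Proof.
intros xs ys h; apply Csub_neq0 in xs, ys.
replace x with (/ / (x - s) + s) by (field; trivial).
rewrite h; field; trivial.
Qed.

Lemma cross_eq0 (u v : C) :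
  v <> 0 -> cross u v = 0%R -> exists t : R, u = t * v.
Proof.
intros hv h; pose proof (C_norm2_neq0 v hv) as nv; unfold cross in h.
(* The coefficient of the orthogonal projection of [u] onto [v]. *)
exists ((fst u * fst v + snd u * snd v) / (fst v * fst v + snd v * snd v))%R.
destruct u as [a b], v as [c d]; simpl in *.
apply injective_projections; simpl;
  apply Rmult_eq_reg_r with (c * c + d * d)%R; trivial; field_simplify; trivial.
- replace (a * d)%R with (b * c)%R by lra.
  transitivity (a * c ^ 2 + d * (a * d))%R; [ring|].
  replace (a * d)%R with (b * c)%R by lra; ring.
- transitivity (b * d ^ 2 + c * (b * c))%R; [ring|].
  replace (b * c)%R with (a * d)%R by lra; ring.
Qed.

Lemma cross_scal_l (t : R) (u v : C) : cross (t * u) v = (t * cross u v)%R.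
Proof. destruct u, v; unfold cross; simpl; ring. Qed.

(** The real part of [n * u] is the scalar product of [u] with the conjugate of [n], so parallel
    normals leave only one direction for [u1] and [u2]. Normals and directions play symmetric roles,
    so for nonzero directions the converse follows by exchanging them. *)
Lemma cross_normals (n1 n2 u1 u2 : C) :
  n1 <> 0 -> n2 <> 0 -> fst (n1 * u1) = 0%R -> fst (n2 * u2) = 0%R ->
  cross n1 n2 = 0%R -> cross u1 u2 = 0%R.
Proof.
intros h1 h2 o1 o2 h.
destruct (cross_eq0 n1 n2 h2 h) as [t ->].
assert (t0 : t <> 0%R) by (intros ->; apply h1; ring).
assert (o : fst (n2 * u1) = 0%R).
{ apply Rmult_eq_reg_l with t; trivial.
  rewrite Rmult_0_r, <- o1; destruct n2, u1; simpl; ring. }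
pose proof (C_norm2_neq0 n2 h2) as nn.
destruct n2 as [a b], u1 as [c d], u2 as [e f]; unfold cross; simpl in *.
apply Rmult_eq_reg_r with (a * a + b * b)%R; trivial.
(* [|n2|^2 * cross u1 u2] is a combination of the two orthogonality relations. *)
transitivity (a * f * (a * c - b * d) - a * d * (a * e - b * f)
  + b * c * (b * f - a * e) + b * e * (a * c - b * d))%R; [ring|].
rewrite o, o2; replace (b * f - a * e)%R with 0%R by lra; ring.
Qed.

(** * Circles through a point under inversion at it *)

(** With [w = z - s], the equation of a circle centred at [c] reads
    [|w|^2 = 2 Re ((c - s) * conj w)]; dividing by [|w|^2] makes it linear in [1 / w]. A straight
    line through [s] goes to a line through 0, whence [k = 0] there. *)
Lemma gcircle_inversion (G : gcircle) (s : C) :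
  on G s ->
  exists (n : C) (k : R), n <> 0 /\
    (forall z, z <> s -> on G z <-> fst (n * / (z - s)) = k) /\
    (forall z, tangent_line G s z <-> line s (Ci * n) z).
Proof.
destruct G as [c r r0 | q d d0]; cbn [on tangent_line]; intro hs.
- assert (cs : c <> s).
  { intros ->; replace (s - s) with (RtoC 0) in hs by ring.
    rewrite Cmod_0 in hs; lra. }
  apply Csub_neq0 in cs.
  exists (c - s), (1 / 2)%R; split; [trivial|split].
  + intros z zs.
    (* Squares may be compared since both sides are non-negative; writing the radius through [s]
       makes the constant terms cancel. *)
    assert (sq : Cmod (z - c) = r <-> (Cmod (z - c) ^ 2 = Cmod (s - c) ^ 2)%R).
    { rewrite hs; split; [intros ->; reflexivity|].
      intro e; apply Rsqr_inj; [apply Cmod_ge_0 | lra |].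
      unfold Rsqr; simpl in e; lra. }
    rewrite sq; unfold Cmod; rewrite 2!pow2_sqrt by nra.
    pose proof (C_norm2_neq0 _ (Csub_neq0 _ _ zs)) as nz.
    destruct z as [x y], s as [a b], c as [e f]; simpl in *.
    match goal with |- _ <-> ?L = _ =>
      replace L with (((e - a) * (x - a) + (f - b) * (y - b)) /
        ((x - a) * (x - a) + (y - b) * (y - b)))%R
        by (field; contradict nz; rewrite <- nz; ring) end.
    assert (nz' : ((x - a) * (x - a) + (y - b) * (y - b) <> 0)%R)
      by (contradict nz; rewrite <- nz; ring).
    split; intro h.
    * apply Rmult_eq_reg_r with ((x - a) * (x - a) + (y - b) * (y - b))%R; trivial.
      unfold Rdiv at 1; rewrite Rmult_assoc, Rinv_l; trivial; lra.
    * apply (f_equal (fun k => k * ((x - a) * (x - a) + (y - b) * (y - b)))%R) in h.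
      unfold Rdiv at 1 in h; rewrite Rmult_assoc, Rinv_l in h; trivial; lra.
  + intro z; split; intros [t ->]; exists (- t)%R; rewrite RtoC_opp; ring.
- destruct hs as [t0 ->].
  (* The normal is [d] turned back by a quarter, so that [Ci * n] is [d] again. *)
  exists (- Ci * d), 0%R; split; [|split].
  + intro h; apply d0; replace d with (Ci * (- Ci * d)).
    * rewrite h; ring.
    * transitivity (- (Ci * Ci) * d); [ring|].
      replace (Ci * Ci) with (- (1)); [ring|].
      apply injective_projections; simpl; ring.
  + intros z zs; split.
    * intros [t ->].
      replace (q + t * d - (q + t0 * d)) with (RtoC (t - t0)%R * d)
        by (rewrite RtoC_minus; ring).
      assert (tt : RtoC (t - t0)%R <> 0).
      { intro h; apply zs; rewrite RtoC_minus in h.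
        replace (t * d) with ((t - t0) * d + t0 * d) by ring; rewrite h; ring. }
      replace (- Ci * d * / (RtoC (t - t0)%R * d)) with (- Ci * / RtoC (t - t0)%R)
        by (field; split; trivial).
      rewrite <- RtoC_inv by (contradict tt; now rewrite tt); simpl; ring.
    * intro h; set (w := z - (q + t0 * d)) in *.
      assert (w0 : w <> 0) by now apply Csub_neq0.
      (* The real part of [- Ci * d / w] is [cross w d / |w|^2]. *)
      destruct (cross_eq0 w d d0) as [t ht].
      { pose proof (C_norm2_neq0 w w0) as nw; unfold cross.
        destruct w as [x y], d as [e f]; simpl in *.
        apply Rmult_eq_reg_r with (/ (x * x + y * y))%R;
          [| now apply Rinv_neq_0_compat].
        rewrite Rmult_0_l, <- h; field.
        contradict nw; rewrite <- nw; ring. }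
      exists (t + t0)%R; rewrite RtoC_plus.
      replace z with (w + (q + t0 * d)) by (unfold w; ring).
      rewrite ht; ring.
  + assert (e : Ci * (- Ci * d) = d).
    { destruct d; apply injective_projections; simpl; ring. }
    rewrite e; intro z; split; intros [t ->].
    * exists (t - t0)%R; rewrite RtoC_minus; ring.
    * exists (t + t0)%R; rewrite RtoC_plus; ring.
Qed.

Lemma line_direction_iff (s u v : C) :
  u <> 0 -> v <> 0 ->
  (forall z, line s u z <-> line s v z) <-> cross u v = 0%R.
Proof.
intros u0 v0; split; intro h.
- destruct (proj1 (h (s + 1 * u))) as [t ht]; [now exists 1%R|].
  replace u with (t * v).
  + rewrite cross_scal_l; unfold cross; ring.
  + transitivity (s + 1 * u - s); [rewrite ht|]; ring.
- destruct (cross_eq0 u v v0 h) as [t ->].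
  assert (t0 : RtoC t <> 0) by (intro e; apply u0; rewrite e; ring).
  intro z; split; intros [k ->].
  + exists (k * t)%R; rewrite RtoC_mult; ring.
  + exists (k * / t)%R; rewrite RtoC_mult, RtoC_inv by congruence; field; trivial.
Qed.

(** The difference of the images of two points of a circle is a direction of its image line, so
    parallel image lines can be read off from the points alone. *)
Lemma tangent_at_iff_parallel (G H : gcircle) (s a b c d : C) :
  a <> s -> b <> s -> c <> s -> d <> s -> a <> b -> c <> d ->
  through G a b s -> through H s c d ->
  tangent_at s G H <->
  cross (/ (a - s) - / (b - s)) (/ (c - s) - / (d - s)) = 0%R.
Proof.
intros a0 b0 c0 d0 ab cd [Ga [Gb Gs]] [Hs [Hc Hd]].
destruct (gcircle_inversion G s Gs) as (n & k & n0 & onG & tanG).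
destruct (gcircle_inversion H s Hs) as (n' & k' & n'0 & onH & tanH).
apply onG in Ga, Gb; trivial; apply onH in Hc, Hd; trivial.
assert (o : fst (n * (/ (a - s) - / (b - s))) = 0%R).
{ replace (n * _) with (n * / (a - s) - n * / (b - s)) by ring.
  rewrite fst_Cminus, Ga, Gb; ring. }
assert (o' : fst (n' * (/ (c - s) - / (d - s))) = 0%R).
{ replace (n' * _) with (n' * / (c - s) - n' * / (d - s)) by ring.
  rewrite fst_Cminus, Hc, Hd; ring. }
assert (T : tangent_at s G H <-> cross n n' = 0%R).
{ assert (Ci0 : forall m : C, m <> 0 -> Ci * m <> 0).
  { intros m m0; apply Cmult_neq_0; trivial.
    intro e; apply (f_equal snd) in e; simpl in e; lra. }
  (* A common quarter turn does not change [cross]. *)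
  replace (cross n n') with (cross (Ci * n) (Ci * n'))
    by (destruct n, n'; unfold cross; simpl; ring).
  rewrite <- (line_direction_iff s) by now apply Ci0.
  unfold tangent_at; split.
  - intros [_ [_ h]] z; now rewrite <- tanG, <- tanH.
  - intro h; split; [trivial | split; [trivial|]].
    intro z; now rewrite tanG, tanH. }
rewrite T; split.
- now apply cross_normals.
(* The same lemma with normals and directions exchanged; the directions are nonzero because
   inversion is injective. *)
- apply cross_normals.
  + apply Csub_neq0; contradict ab; now apply Cinv_sub_inj with s.
  + apply Csub_neq0; contradict cd; now apply Cinv_sub_inj with s.
  + now rewrite Cmult_comm.
  + now rewrite Cmult_comm.
Qed.

(** If the images of [x], [y], [z] were collinear, the circle through [x], [z], [s] would also
    contain [y], since its image is the line through the images of [x] and [z]. *)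
Lemma not_concyclic_cross (x s y z : C) :
  x <> s -> y <> s -> z <> s -> z <> x ->
  ~ concyclic x s y z ->
  cross (/ (x - s) - / (z - s)) (/ (y - s) - / (z - s)) <> 0%R.
Proof.
intros xs ys zs zx nc h; apply nc.
destruct (through_exists x z s) as (G & Gx & Gz & Gs);
  [congruence | trivial.. |].
exists G; repeat split; trivial.
destruct (gcircle_inversion G s Gs) as (n & k & n0 & onG & _).
apply onG in Gx, Gz; trivial; apply onG; trivial.
assert (u0 : / (x - s) - / (z - s) <> 0).
{ apply Csub_neq0; intro e; apply zx; symmetry; now apply Cinv_sub_inj with s. }
destruct (cross_eq0 (/ (y - s) - / (z - s)) (/ (x - s) - / (z - s)) u0) as [t ht].
{ rewrite <- Ropp_0, <- h; unfold cross; ring. }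
replace (/ (y - s)) with (/ (z - s) + t * (/ (x - s) - / (z - s)))
  by (rewrite <- ht; ring).
replace (n * _)
  with (n * / (z - s) + t * (n * / (x - s) - n * / (z - s))) by ring.
rewrite fst_Cplus, fst_scal, fst_Cminus, Gx, Gz; ring.
Qed.

(** * The parallelogram and the three equations *)

(** The defect [p + m - r - l] is parallel to both [l - m] and [r - m], which are independent, so it
    is zero. *)
Lemma parallelogram (l r m p : C) :
  cross (l - m) (r - m) <> 0%R ->
  cross (l - m) (r - p) = 0%R /\ cross (r - m) (l - p) = 0%R <->
  p + m = r + l.
Proof.
intro ind; split.
- intros [h1 h2].
  assert (k1 : cross (l - m) (p + m - r - l) = 0%R).
  { rewrite <- Ropp_0, <- h1; unfold cross; simpl; ring. }
  assert (k2 : cross (r - m) (p + m - r - l) = 0%R).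
  { rewrite <- Ropp_0, <- h2; unfold cross; simpl; ring. }
  assert (e : p + m - r - l = 0).
  { destruct (p + m - r - l) as [x y]; destruct (l - m) as [a b];
      destruct (r - m) as [c d]; unfold cross in *; simpl in *.
    apply injective_projections; simpl;
      apply Rmult_eq_reg_l with (a * d - b * c)%R; trivial.
    (* Cramer's rule for the two vanishing cross products. *)
    - transitivity (c * (a * y - b * x) - a * (c * y - d * x))%R; [ring|].
      rewrite k1, k2; ring.
    - transitivity (d * (a * y - b * x) - b * (c * y - d * x))%R; [ring|].
      rewrite k1, k2; ring. }
  transitivity (p + m - r - l + (r + l)); [ring | rewrite e; ring].
- intro e; replace p with (r + l - m) by (rewrite <- e; ring).
  split; unfold cross; simpl; ring.
Qed.

Lemma Cdiv_eq_opp1 (x y : C) : y <> 0 -> x / y = - (1) <-> x + y = 0.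
Proof.
intro y0; split; intro h.
- replace x with (x / y * y) by (field; trivial); rewrite h; ring.
- replace x with (x + y - y) by ring; rewrite h; field; trivial.
Qed.

Lemma Cmult_eq0_r (k x : C) : k <> 0 -> k * x = 0 <-> x = 0.
Proof.
intro k0; split; [|intros ->; ring].
intro h; replace x with (/ k * (k * x)) by (field; trivial); rewrite h; ring.
Qed.

Lemma Csub_eq0 (x y : C) : x - y = 0 <-> x = y.
Proof.
split; [|intros ->; ring].
intro h; replace x with (x - y + y) by ring; rewrite h; ring.
Qed.

(* Sl, S, Sr are S_{i-1}, S_i, S_{i+1}; Sm, Sp are S_i^-, S_i^+. *)
Theorem proposition5p16 (Sl S Sr Sm Sp : C)
  (Sl_S : Sl <> S) (Sr_S : Sr <> S)
  (Sm_S : Sm <> S) (Sm_Sl : Sm <> Sl) (Sm_Sr : Sm <> Sr)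
  (Sp_S : Sp <> S) :
  let eq1 :=
    1 / (Sp - S) + 1 / (Sm - S) = 1 / (Sr - S) + 1 / (Sl - S) in
  let eq2 :=
    ((Sp - Sr) * (S - Sm) * (S - Sl)) / ((Sp - S) * (Sr - S) * (Sm - Sl))
    = - (1) in
  let eq3 :=
    ((Sp - Sl) * (S - Sm) * (Sr - S)) / ((Sp - S) * (S - Sl) * (Sm - Sr))
    = - (1) in
  (eq1 <-> eq2) /\ (eq1 <-> eq3) /\
  (~ concyclic Sl S Sr Sm -> Sp <> Sl -> Sp <> Sr ->
   forall G1 H1 G2 H2 : gcircle,
     through G1 Sl Sm S -> through H1 S Sr Sp ->
     through G2 Sr Sm S -> through H2 S Sl Sp ->
     (tangent_at S G1 H1 /\ tangent_at S G2 H2 <-> eq1)).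
Proof.
intros eq1 eq2 eq3.
pose proof (Csub_neq0 _ _ Sl_S) as l0; pose proof (Csub_neq0 _ _ Sr_S) as r0.
pose proof (Csub_neq0 _ _ Sm_S) as m0; pose proof (Csub_neq0 _ _ Sp_S) as p0.
pose proof (Csub_neq0 _ _ Sm_Sl) as ml; pose proof (Csub_neq0 _ _ Sm_Sr) as mr.
assert (l0' : S - Sl <> 0) by (apply Csub_neq0; congruence).
assert (E : eq1 <->
  / (Sp - S) + / (Sm - S) = / (Sr - S) + / (Sl - S)).
{ unfold eq1, Cdiv; now rewrite !Cmult_1_l. }
split; [|split].
- rewrite E; unfold eq2.
  rewrite Cdiv_eq_opp1 by (repeat apply Cmult_neq_0; trivial).
  (* Clearing denominators in [eq1] gives exactly numerator plus denominator of [eq2]; the factor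
     [S - Sl], rather than [Sl - S], fixes the sign. *)
  rewrite <- Csub_eq0,
    <- (Cmult_eq0_r ((Sp - S) * (Sm - S) * (Sr - S) * (S - Sl)))
    by (repeat apply Cmult_neq_0; trivial).
  match goal with |- ?a = _ <-> ?b = _ => replace b with a; [reflexivity|] end.
  field; repeat split; trivial.
- rewrite E; unfold eq3.
  rewrite Cdiv_eq_opp1 by (repeat apply Cmult_neq_0; trivial).
  (* [eq3] is [eq2] with [Sl] and [Sr] exchanged, written with two signs reversed; here [Sl - S] is
     the factor that matches. *)
  rewrite <- Csub_eq0,
    <- (Cmult_eq0_r ((Sp - S) * (Sm - S) * (Sr - S) * (Sl - S)))
    by (repeat apply Cmult_neq_0; trivial).
  match goal with |- ?a = _ <-> ?b = _ => replace b with a; [reflexivity|] end.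
  field; repeat split; trivial.
- intros nc Sp_Sl Sp_Sr G1 H1 G2 H2 g1 h1 g2 h2.
  rewrite E.
  rewrite (tangent_at_iff_parallel G1 H1 S Sl Sm Sr Sp) by (trivial; congruence).
  rewrite (tangent_at_iff_parallel G2 H2 S Sr Sm Sl Sp) by (trivial; congruence).
  (* Both tangencies are now parallelisms between sides of the quadrilateral of images;
     non-concyclicity makes it non-degenerate. *)
  apply parallelogram, not_concyclic_cross; trivial.
Qed.
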